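(* Let $\rho$ be a compatible $sl_2(\mathbb{C})$-representation on $A=\bigoplus_{n=0}^{2N}A^n$ and let $\rho_\varepsilon=\rho+\varepsilon[\rho,\varphi]$ be a compatible infinitesimal deformation of $\rho$ (with $\varphi\in\mathrm{End}_{\mathbb{C}}(A)$ homogeneous of degree $0$) such that $L_\varepsilon=L+\varepsilon v$, where $v\in A^2$ acts by multiplication. Let $j\ge0$ and $\alpha\in P^{n-2j}$. Then the primitive decomposition of $L^j(\alpha)$ with respect to $\rho_\varepsilon$ takes the form $$L^j(\alpha)=L_\varepsilon^{j+1}\bigl(\varepsilon(N-n+j+1)Q^2_v(\alpha)\bigr)+L^j_\varepsilon\bigl(\alpha-\varepsilon((N-n+2j+1)LQ_v^2(\alpha)+jQ^1_v(\alpha))\bigr)-L_\varepsilon^{j-1}\bigl(\varepsilon jQ_v^0(\alpha)\bigr),$$ that is, this identity holds in $A[\varepsilon]$ and the elements to which $L_\varepsilon^{j+1}$, $L_\varepsilon^{j}$, $L_\varepsilon^{j-1}$ are applied are primitive with respect to $\rho_\varepsilon$.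
   Context: $A=\bigoplus_{n=0}^{2N}A^n$ is a finite dimensional graded $\mathbb{C}$-algebra which is $\mathbb{Z}/2\mathbb{Z}$-commutative (graded commutative) with respect to the grading $A=A^{even}\oplus A^{odd}$. A representation $\rho:sl_2(\mathbb{C})\to \mathrm{End}_{\mathbb{C}}(A)$ is given by the action of the generators $L=\begin{pmatrix}0&0\\1&0\end{pmatrix}$, $\Lambda=\begin{pmatrix}0&1\\0&0\end{pmatrix}$, $B=\begin{pmatrix}1&0\\0&-1\end{pmatrix}$ (their images in $\mathrm{End}_{\mathbb C}(A)$ are denoted by the same letters). It is compatible if $L$ and $\Lambda$ are homogeneous of degree $2$ and $-2$, respectively, $B|_{A^n}=(N-n)\cdot\mathrm{id}$, and $L(\alpha\beta)=L(\alpha)\beta$ for all $\alpha,\beta\in A$. Put $P^m:=\ker(\Lambda:A^m\to A^{m-2})$ (primitive elements); one has the primitive decomposition $A^n=\bigoplus_{j\ge0}L^jP^{n-2j}$. Infinitesimal deformations: for $\varphi\in\mathrm{End}_{\mathbb{C}}(A)$ the deformation $\rho_\varepsilon$ on $A[\varepsilon]=A\otimes\mathbb{C}[\varepsilon]/(\varepsilon^2)$ is $\rho_\varepsilon(X)=(\mathrm{id}+\varepsilon\varphi)^{-1}\rho(X)(\mathrm{id}+\varepsilon\varphi)=\rho(X)+\varepsilon[\rho(X),\varphi]$; $L_\varepsilon=L+\varepsilon[L,\varphi]$, $\Lambda_\varepsilon=\Lambda+\varepsilon[\Lambda,\varphi]$. The condition $L_\varepsilon=L+\varepsilon v$ means that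 $[L,\varphi]$ is multiplication by $v\in A^2$. An element of $A[\varepsilon]$ is $\rho_\varepsilon$-primitive if it is annihilated by $\Lambda_\varepsilon$; a primitive decomposition with respect to $\rho_\varepsilon$ of $x\in A[\varepsilon]$ of degree $n$ is $x=\sum_k L_\varepsilon^k(x_k)$ with $x_k$ $\rho_\varepsilon$-primitive of degree $n-2k$. The linear maps $Q_v^i:P^m\to P^{m-2i+2}$ ($i\ge0$) are defined by the primitive decomposition $v\alpha=\sum_{i\ge0}L^iQ_v^i(\alpha)$ of the product, for $\alpha\in P^m$. (For $m=N$ the element $Q_v^1(\alpha)\in P^N$ is annihilated by $L$ and is not determined by this; any choice, e.g. $0$, may be taken.) The term with $L_\varepsilon^{j-1}$ is zero for $j=0$. *)

(* Defs.v *)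
From HB Require Import structures.
From mathcomp Require Import all_boot all_order all_algebra all_field.
From mathcomp Require Import reals complex.

Set Implicit Arguments.
Unset Strict Implicit.
Unset Printing Implicit Defensive.

Import Order.TTheory GRing.Theory Num.Theory.
Local Open Scope ring_scope.

Section Commutator.
Variables (F : fieldType) (V : vectType F).
Definition lfun_comm (f g : 'End(V)) : 'End(V) := ((f \o g) - (g \o f))%VF.

Lemma lfun_commE f g u : lfun_comm f g u = f (g u) - g (f u).
Proof. by rewrite add_lfunE opp_lfunE !comp_lfunE. Qed.
End Commutator.

Section Sl2.
Variable F : fieldType.

Definition sl2_vspace : {vspace 'M[F]_2} :=
  lker (linfun (@mxtrace F 2 : 'M[F]_2 -> F^o)).

Definition sl2 := subvs_of sl2_vspace.

(* vsproj projects onto sl2_vspace: it is the identity on trace-zero matrices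
   (sl2_projK), and is only ever applied to those below. *)
Definition sl2_proj (M : 'M[F]_2) : sl2 := vsproj sl2_vspace M.

Lemma sl2_projK M : \tr M = 0 -> vsval (sl2_proj M) = M.
Proof. by move=> tr0; rewrite vsprojK // memv_ker lfunE /= tr0. Qed.

Definition sl2_bracket (X Y : sl2) : sl2 :=
  sl2_proj (vsval X *m vsval Y - vsval Y *m vsval X).

Lemma sl2_bracketE X Y :
  vsval (sl2_bracket X Y) = vsval X *m vsval Y - vsval Y *m vsval X.
Proof. by rewrite sl2_projK // linearB /= mxtrace_mulC subrr. Qed.

Definition sl2L : sl2 := sl2_proj (delta_mx 1 0).
Definition sl2Lam : sl2 := sl2_proj (delta_mx 0 1).
Definition sl2B : sl2 := sl2_proj (delta_mx 0 0 - delta_mx 1 1).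

Lemma sl2LE : vsval sl2L = delta_mx 1 0.
Proof. by rewrite sl2_projK // /mxtrace !big_ord_recl big_ord0 !mxE !addr0. Qed.

Lemma sl2LamE : vsval sl2Lam = delta_mx 0 1.
Proof. by rewrite sl2_projK // /mxtrace !big_ord_recl big_ord0 !mxE !addr0. Qed.

Lemma sl2BE : vsval sl2B = delta_mx 0 0 - delta_mx 1 1.
Proof.
rewrite sl2_projK // /mxtrace !big_ord_recl big_ord0 !mxE /=.
by rewrite addr0 sub0r subr0 subrr.
Qed.

Definition sl2_representation (V : vectType F) (rho : sl2 -> 'End(V)) : Prop :=
  linear rho /\
  forall X Y, rho (sl2_bracket X Y) = lfun_comm (rho X) (rho Y).

End Sl2.

Arguments sl2L {F}.
Arguments sl2Lam {F}.
Arguments sl2B {F}.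

(* Gradings are indexed by int, with zero components outside [0, 2N], so that
   degrees such as -2 and n - 2j need no truncated subtraction. *)
Section Graded.
Variables (F : fieldType) (A : falgType F) (N : nat) (gr : int -> {vspace A}).

Record graded_algebra : Prop := GradedAlgebra {
  graded_out : forall n : int, ~~ (0 <= n <= (2 * N)%N%:Z) -> gr n = 0%VS;
  graded_full : (\sum_(i < (2 * N).+1) gr i%:Z)%VS = fullv;
  graded_direct : directv (\sum_(i < (2 * N).+1) gr i%:Z)%VS;
  graded_one : 1 \in gr 0;
  graded_mul : forall (m n : int) (a b : A),
    a \in gr m -> b \in gr n -> a * b \in gr (m + n)
}.

(* A^even for p = false, A^odd for p = true. *)
Definition parity_part (p : bool) : {vspace A} :=
  (\sum_(i < (2 * N).+1 | odd i == p) gr i%:Z)%VS.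

Definition graded_commutative : Prop :=
  forall (p q : bool) (a b : A),
    a \in parity_part p -> b \in parity_part q ->
    a * b = (-1) ^+ (p && q) * (b * a).

Definition homogeneous (d : int) (f : 'End(A)) : Prop :=
  forall (n : int) (a : A), a \in gr n -> f a \in gr (n + d).

Record compatible (rho : sl2 F -> 'End(A)) : Prop := Compatible {
  compatible_rep : sl2_representation rho;
  compatible_L : homogeneous 2 (rho sl2L);
  compatible_Lam : homogeneous (- 2) (rho sl2Lam);
  compatible_B : forall (n : int) (a : A),
    a \in gr n -> rho sl2B a = (N%:R - n%:~R) *: a;
  compatible_mul : forall a b : A, rho sl2L (a * b) = rho sl2L a * b
}.

Definition primitive (rho : sl2 F -> 'End(A)) (m : int) : {vspace A} :=
  (gr m :&: lker (rho sl2Lam))%VS.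

(* The restriction of Q i to P^m is Q_v^i : P^m -> P^(m-2i+2); a family of
   linear maps on the P^m, which form a direct sum, extends to one
   endomorphism of A.  As P^(m-2i+2) = 0 for m <= 2N and i > N + 1, the sum over
   all i stops at N + 1.  Nothing else is asked of Q: where the decomposition
   does not determine Q i, any linear choice is allowed. *)
Definition primitive_components (rho : sl2 F -> 'End(A)) (v : A)
    (Q : nat -> 'End(A)) : Prop :=
  forall (m : int) (a : A), a \in primitive rho m ->
    (forall i : nat, Q i a \in primitive rho (m - 2 * i%:Z + 2)) /\
    v * a = \sum_(i < N.+2) iter i (rho sl2L) (Q i a).

End Graded.

(* A[e] = A (x) F[e]/(e^2): Dual a b stands for a + e b. *)
Record dual (V : Type) : Type := Dual { dual_re : V; dual_im : V }.

Section DualNumbers.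
Variables (F : fieldType) (A : falgType F).

Definition dual_pair (x : dual A) : A * A := (dual_re x, dual_im x).
Definition pair_dual (p : A * A) : dual A := Dual p.1 p.2.

Lemma dual_pairK : cancel dual_pair pair_dual. Proof. by case. Qed.

HB.instance Definition _ := Choice.copy (dual A) (can_type dual_pairK).

Definition dual_zero : dual A := Dual 0 0.
Definition dual_opp (x : dual A) : dual A := Dual (- dual_re x) (- dual_im x).
Definition dual_add (x y : dual A) : dual A :=
  Dual (dual_re x + dual_re y) (dual_im x + dual_im y).

Fact dual_addA : associative dual_add.
Proof. by move=> x y z; rewrite /dual_add /= !addrA. Qed.

Fact dual_addC : commutative dual_add.
Proof. by move=> x y; congr Dual; apply: addrC. Qed.

Fact dual_add0 : left_id dual_zero dual_add.
Proof. by case=> a b; rewrite /dual_add /= !add0r. Qed.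

Fact dual_addN : left_inverse dual_zero dual_opp dual_add.
Proof. by case=> a b; rewrite /dual_add /= !addNr. Qed.

HB.instance Definition _ := GRing.isZmodule.Build (dual A)
  dual_addA dual_addC dual_add0 dual_addN.

Definition dual_scale (k : F) (x : dual A) : dual A :=
  Dual (k *: dual_re x) (k *: dual_im x).

Fact dual_scaleA k l x : dual_scale k (dual_scale l x) = dual_scale (k * l) x.
Proof. by rewrite /dual_scale /= !scalerA. Qed.

Fact dual_scale1 : left_id 1 dual_scale.
Proof. by case=> a b; rewrite /dual_scale /= !scale1r. Qed.

Fact dual_scaleDr : right_distributive dual_scale +%R.
Proof. by move=> k x y; congr Dual; apply: scalerDr. Qed.

Fact dual_scaleDl x : {morph dual_scale^~ x : k l / k + l}.
Proof. by move=> k l; congr Dual; apply: scalerDl. Qed.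

HB.instance Definition _ := GRing.Zmodule_isLmodule.Build F (dual A)
  dual_scaleA dual_scale1 dual_scaleDr dual_scaleDl.

Import VectorInternalTheory.

Fact dual_vect_axiom : Vector.axiom (dim A + dim A) (dual A).
Proof.
pose f (x : dual A) : 'rV[F]_(dim A + dim A) :=
  row_mx (v2r (dual_re x)) (v2r (dual_im x)).
pose g (r : 'rV[F]_(dim A + dim A)) : dual A :=
  Dual (r2v (lsubmx r) : A) (r2v (rsubmx r) : A).
exists f; last exists g.
- by move=> k x y; rewrite scale_row_mx add_row_mx -!linearP.
- by case=> a b; rewrite /g row_mxKl row_mxKr !v2rK.
- by move=> r; rewrite /f !r2vK hsubmxK.
Qed.

HB.instance Definition _ :=
  Lmodule_hasFinDim.Build F (dual A) dual_vect_axiom.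

Definition dual_one : dual A := Dual 1 0.
Definition dual_mul (x y : dual A) : dual A :=
  Dual (dual_re x * dual_re y) (dual_re x * dual_im y + dual_im x * dual_re y).

Fact dual_mulA : associative dual_mul.
Proof.
move=> x y z; congr Dual; first exact: mulrA.
by rewrite /= mulrDr mulrDl !mulrA addrA.
Qed.

Fact dual_mul1l : left_id dual_one dual_mul.
Proof. by case=> a b; rewrite /dual_mul /= !mul1r mul0r addr0. Qed.

Fact dual_mul1r : right_id dual_one dual_mul.
Proof. by case=> a b; rewrite /dual_mul /= !mulr1 mulr0 add0r. Qed.

Fact dual_mulDl : left_distributive dual_mul +%R.
Proof.
move=> x y z; congr Dual; first exact: mulrDl.
by rewrite /= !mulrDl addrACA.
Qed.

Fact dual_mulDr : right_distributive dual_mul +%R.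
Proof.
move=> x y z; congr Dual; first exact: mulrDr.
by rewrite /= !mulrDr addrACA.
Qed.

Fact dual_one_neq0 : dual_one != 0.
Proof. by apply/eqP=> /(congr1 (@dual_re A)) /eqP; rewrite oner_eq0. Qed.

HB.instance Definition _ := GRing.Zmodule_isNzRing.Build (dual A)
  dual_mulA dual_mul1l dual_mul1r dual_mulDl dual_mulDr dual_one_neq0.

Fact dual_scaleAl (k : F) (x y : dual A) : k *: (x * y) = (k *: x) * y.
Proof.
congr Dual; first exact: scalerAl.
by rewrite /= scalerDr !scalerAl.
Qed.

HB.instance Definition _ :=
  GRing.Lmodule_isLalgebra.Build F (dual A) dual_scaleAl.

Fact dual_scaleAr (k : F) (x y : dual A) : k *: (x * y) = x * (k *: y).
Proof.
congr Dual; first exact: scalerAr.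
by rewrite /= scalerDr !scalerAr.
Qed.

HB.instance Definition _ :=
  GRing.Lalgebra_isAlgebra.Build F (dual A) dual_scaleAr.

HB.instance Definition _ := Algebra_isFalgebra.Build F (dual A).

Definition eps : dual A := Dual 0 1.
Definition dconst (a : A) : dual A := Dual a 0.

Lemma eps_dconst a : eps * dconst a = Dual 0 a.
Proof. by congr Dual; rewrite /= ?mul0r // mul1r add0r. Qed.

Fact dual_re_is_linear : linear (@dual_re A : dual A -> A).
Proof. by []. Qed.
HB.instance Definition _ := GRing.isLinear.Build F (dual A) A _
  (@dual_re A : dual A -> A) dual_re_is_linear.

Fact dual_im_is_linear : linear (@dual_im A : dual A -> A).
Proof. by []. Qed.
HB.instance Definition _ := GRing.isLinear.Build F (dual A) A _
  (@dual_im A : dual A -> A) dual_im_is_linear.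

(* A[e]^n = A^n (x) F[e]/(e^2) *)
Definition dual_gr (gr : int -> {vspace A}) (n : int) : {vspace dual A} :=
  (linfun (@dual_re A) @^-1: gr n :&: linfun (@dual_im A) @^-1: gr n)%VS.

Lemma mem_dual_gr gr n x :
  (x \in dual_gr gr n) = (dual_re x \in gr n) && (dual_im x \in gr n).
Proof. by rewrite memv_cap -!memv_preim !lfunE. Qed.

Definition dual_map (f : 'End(A)) (x : dual A) : dual A :=
  Dual (f (dual_re x)) (f (dual_im x)).

Fact dual_map_is_linear f : linear (dual_map f).
Proof. by move=> k x y; congr Dual; apply: linearP. Qed.
HB.instance Definition _ f := GRing.isLinear.Build F (dual A) (dual A) _
  (dual_map f) (dual_map_is_linear f).

(* f (x) id on A (x) F[e]/(e^2) *)
Definition dual_ext (f : 'End(A)) : 'End(dual A) := linfun (dual_map f).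

Lemma dual_extE f x : dual_ext f x = Dual (f (dual_re x)) (f (dual_im x)).
Proof. by rewrite lfunE. Qed.

(* e f as an endomorphism of A[e] *)
Definition eps_ext (f : 'End(A)) : 'End(dual A) := (amull eps \o dual_ext f)%VF.

Lemma eps_extE f x : eps_ext f x = Dual 0 (f (dual_re x)).
Proof.
rewrite comp_lfunE lfunE /= dual_extE.
by congr Dual; rewrite /= ?mul0r // mul1r add0r.
Qed.

Definition rho_eps (rho : sl2 F -> 'End(A)) (phi : 'End(A)) (X : sl2 F) :
    'End(dual A) :=
  dual_ext (rho X) + eps_ext (lfun_comm (rho X) phi).

Lemma rho_eps_conj rho phi X :
  rho_eps rho phi X =
  ((\1 + eps_ext phi)^-1 \o (dual_ext (rho X) \o (\1 + eps_ext phi)))%VF.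
Proof.
have ker0 : lker (\1 + eps_ext phi)%VF == 0%VS.
  apply/eqP/vspaceP => x; rewrite memv_ker memv0 add_lfunE id_lfunE eps_extE.
  apply/eqP/eqP => [|->]; last by congr Dual; rewrite ?addr0 //= linear0 addr0.
  case: x => a b [/= ]; rewrite addr0 => ->; by rewrite linear0 addr0 => ->.
apply/lfunP => x; apply: (lker0P ker0).
rewrite [in RHS]comp_lfunE lker0_lfunVK //.
rewrite !comp_lfunE !(add_lfunE, id_lfunE, eps_extE, dual_extE) /=.
congr Dual; rewrite /= ?addr0 //.
rewrite !(add_lfunE, opp_lfunE, comp_lfunE) [RHS]linearD.
by rewrite -addrA subrK.
Qed.

End DualNumbers.

Arguments eps {F A}.

(* Main.v *)
From HB Require Import structures.
Require Import Defs.
From mathcomp Require Import all_boot all_order all_algebra all_field.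
From mathcomp Require Import reals complex ring zify.

Import Order.TTheory GRing.Theory Num.Theory.
Local Open Scope ring_scope.

Set Implicit Arguments.
Unset Strict Implicit.

(** Write [V] for the operator of multiplication by [v] on [A], and let sl2 act
    on [End A] by commutators.  By graded commutativity [V] commutes with [L],
    and it has degree 2, so it is an extremal vector of a string of length
    three: [[Lam, [Lam, [Lam, V]]]] would commute with [L] while having degree
    -4, and no nonzero operator of negative degree commutes with [L]
    ([commutant_negative_degree], [ad_Lam3_amull]).

    As [Lam] kills [alpha], iterating [Lam] on [v * alpha] amounts to iterating
    [ad Lam] on [V] ([iter_ad_apply]).  Hence [Lam^3 (v * alpha) = 0], and the
    primitive decomposition of [v * alpha] stops after three terms:
    [v * alpha = Q0 + L Q1 + L^2 Q2] ([mul_primitive]).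

    Likewise [[Lam, phi]] is determined by [[L, phi] = V]: the operators
    [[Lam, [Lam, V]]] and [2 [Lam, phi]] have the same commutator with [L] and
    degree -2, so they are equal ([double_comm_Lam_phi]).  With the weight [w]
    of [alpha] this gives [[Lam, phi] alpha = (w + 1) (w + 2) Q2]
    ([comm_Lam_phi_primitive]), and the term [(w + 1) L Q2] in the corrected
    primitive element is exactly what [Lam] sends to this.

    The decomposition itself is then a comparison of coefficients of [eps],
    because [L_eps^k = L^k + eps k L^(k-1) V] ([iter_rho_epsL]). *)

(** * Iterates of an endomorphism *)

Section IterLfun.
Variables (K : fieldType) (V : vectType K) (f : 'End(V)).

Lemma iter_lfun0 k : iter k f 0 = 0.
Proof. by elim: k => //= k ->; rewrite linear0. Qed.

Lemma iter_lfunD k x y : iter k f (x + y) = iter k f x + iter k f y.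
Proof. by elim: k => //= k ->; rewrite linearD. Qed.

Lemma iter_lfunZ k c x : iter k f (c *: x) = c *: iter k f x.
Proof. by elim: k => //= k ->; rewrite linearZ. Qed.

Lemma iter_lfunN k x : iter k f (- x) = - iter k f x.
Proof. by rewrite -scaleN1r iter_lfunZ scaleN1r. Qed.

Lemma iter_lfun_sum k n (x : nat -> V) :
  iter k f (\sum_(i < n) x i) = \sum_(i < n) iter k f (x i).
Proof.
elim: n => [|n IH]; first by rewrite !big_ord0 iter_lfun0.
by rewrite !big_ord_recr iter_lfunD IH.
Qed.

End IterLfun.

(** * Weight strings of sl2-triples *)

Section Sl2Triple.
Variables (K : numFieldType) (V : vectType K).
Implicit Types (E F H : 'End(V)) (x : V).

(** A representation of sl2 given by the images of the generators; this form
    also covers the adjoint action and the exchange of [E] and [F]. *)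
Record sl2_triple E F H : Prop := Sl2Triple {
  triple_EF : lfun_comm E F = H;
  triple_HE : lfun_comm H E = 2 *: E;
  triple_HF : lfun_comm H F = (- 2) *: F
}.

Lemma sl2_triple_swap E F H : sl2_triple E F H -> sl2_triple F E (- H).
Proof.
have commN f g : lfun_comm (- f) g = - lfun_comm f g.
  by apply/lfunP=> x; rewrite !(lfun_commE, opp_lfunE) linearN opprB opprK addrC.
case=> EF HE HF; split; rewrite ?commN ?HE ?HF ?scaleNr ?opprK //.
by rewrite -EF opprB.
Qed.

(** Admitting [x = 0] spares a case distinction for components that vanish. *)
Definition weight_vector E H (mu : K) x := E x = 0 /\ H x = mu *: x.

Section WeightString.
Variables (E F H : 'End(V)).
Hypothesis tr : sl2_triple E F H.

Lemma weight_iter mu x k :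
  weight_vector E H mu x -> H (iter k F x) = (mu - 2 * k%:R) *: iter k F x.
Proof.
case=> _ Hx; elim: k => [|k IH]; first by rewrite mulr0 subr0.
have /eqP := congr1 (fun f : 'End(V) => f (iter k F x)) (triple_HF tr).
rewrite lfun_commE scale_lfunE subr_eq => /eqP /= ->.
rewrite IH linearZ /= -scalerDl; congr (_ *: _).
by rewrite -natr1; ring.
Qed.

(** [E F^(k+1) x] is the sum of the contributions [H] of the [k + 1] factors
    [F] that [E] passes, and [H] has eigenvalues [mu, mu - 2, ..., mu - 2 k]
    there. *)
Lemma raise_iter mu x k : weight_vector E H mu x ->
  E (iter k.+1 F x) = (k.+1%:R * (mu - k%:R)) *: iter k F x.
Proof.
move=> wx; have [Ex Hx] := wx.
have EFy y : E (F y) = H y + F (E y) by rewrite -(triple_EF tr) lfun_commE subrK.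
elim: k => [|k IH]; first by rewrite /= EFy Ex linear0 addr0 Hx subr0 mul1r.
rewrite [iter k.+2 F x]/= EFy IH linearZ /= -/(iter k.+1 F x) (weight_iter _ wx).
rewrite -scalerDl; congr (_ *: _).
by rewrite -!natr1; ring.
Qed.

Lemma raise_iter_iter mu x k : weight_vector E H mu x ->
  iter k E (iter k F x) = (k`!%:R * \prod_(t < k) (mu - t%:R)) *: x.
Proof.
move=> wx; elim: k => [|k IH]; first by rewrite big_ord0 mulr1 scale1r.
rewrite iterSr (raise_iter _ wx) iter_lfunZ IH scalerA big_ord_recr factS natrM.
by congr (_ *: _); rewrite /=; ring.
Qed.

Lemma raise_iter_eq0 mu x i k : weight_vector E H mu x -> (i < k)%N ->
  iter k E (iter i F x) = 0.
Proof.
move=> wx /subnK <-; rewrite iterD iterS (raise_iter_iter _ wx).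
by rewrite linearZ /= (proj1 wx) scaler0 iter_lfun0.
Qed.

(** Both [F^2 x] and [2 F y] are raised by [E] to [2 F x]: the string of weight
    2 passes through weight 0, where [y] can take the place of [F x / 2] up to
    the kernel of [E].  For commutators, this turns a solution [phi] of
    [[L, phi] = V] into a formula for [[Lam, phi]]. *)
Lemma weight2_second_lowering x y :
  weight_vector E H 2 x -> H y = 0 -> E y = x -> E (iter 2 F x - 2 *: F y) = 0.
Proof.
move=> wx Hy Eyx; rewrite linearB linearZ /= -[F (F x)]/(iter 2 F x).
rewrite (raise_iter 1 wx) /=.
have -> : E (F y) = H y + F (E y) by rewrite -(triple_EF tr) lfun_commE subrK.
rewrite Hy add0r Eyx -scalerBl.
have -> : 2 * (2 - 1%:R) - 2 = 0 :> K by ring.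
by rewrite scale0r.
Qed.

(** At the last nonzero step [F^t x] of the string, [raise_iter] gives
    [(t + 1) (mu - t) = 0]. *)
Lemma natural_weight mu x k : weight_vector E H mu x -> iter k F x = 0 ->
  x = 0 \/ exists t : nat, mu = t%:R.
Proof.
move=> wx; elim: k => [|k IH] Fx; first by left.
have /eqP := raise_iter k wx; rewrite Fx linear0 eq_sym scaler_eq0.
rewrite mulf_eq0 pnatr_eq0 /= subr_eq0 => /orP[/eqP ->|/eqP /IH //].
by right; exists k.
Qed.

(** Applying [E^(n-1)] to the sum isolates a nonzero multiple of the last
    [q (n - 1)], since it kills the shorter strings; so the components with
    index at least [s] vanish one after the other from the top.  The condition
    on [mu] says that [F^i (q i)] is not beyond the end of its string. *)
Lemma string_components_eq0 (s n : nat) (mu : nat -> K) (q : nat -> V) :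
    (forall i, weight_vector E H (mu i) (q i)) ->
    (forall i t : nat, (s <= i)%N -> (t < i)%N -> mu i != t%:R) ->
    iter s E (\sum_(i < n) iter i F (q i)) = 0 ->
  forall i, (s <= i < n)%N -> q i = 0.
Proof.
move=> wq mu_neq; elim: n => [|n IH] Es0 i /andP[le_si]; first by rewrite ltn0.
rewrite ltnS leq_eqVlt => le_in.
have qn0 : (s <= n)%N -> q n = 0.
  move=> le_sn; have := congr1 (iter (n - s) E) Es0.
  rewrite -iterD subnK // iter_lfun0.
  rewrite (iter_lfun_sum _ _ _ (fun i => iter i F (q i))).
  rewrite big_ord_recr /= big1 => [|t _]; last first.
    exact: raise_iter_eq0 (wq t) (ltn_ord t).
  rewrite add0r (raise_iter_iter _ (wq n)) => /eqP; rewrite scaler_eq0.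
  rewrite mulf_eq0 pnatr_eq0 gtn_eqF ?fact_gt0 //= => /orP[|/eqP //].
  case/prodf_eq0=> [t _]; rewrite subr_eq0.
  by rewrite (negPf (mu_neq _ _ le_sn (ltn_ord t))).
case/predU1P: le_in le_si => [-> //|lt_in le_si].
apply: IH; last by rewrite le_si.
move: Es0; rewrite big_ord_recr /= qn0 ?(leq_trans le_si (ltnW lt_in)) //.
by rewrite iter_lfun0 addr0.
Qed.

End WeightString.
End Sl2Triple.

(** * The adjoint action on endomorphisms *)

Section Adjoint.
Variables (K : numFieldType) (V : vectType K).
Implicit Types (f g : 'End(V)).

Fact lfun_comm_is_linear f : linear (lfun_comm f).
Proof.
move=> k g1 g2; apply/lfunP=> x; rewrite !(lfun_commE, add_lfunE, scale_lfunE).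
by rewrite linearD linearZ /= scalerBr addrACA opprD.
Qed.
HB.instance Definition _ f := GRing.isLinear.Build K 'End(V) 'End(V) _
  (lfun_comm f) (lfun_comm_is_linear f).

Definition ad f : 'End('End(V)) := linfun (lfun_comm f).

Lemma adE f g : ad f g = lfun_comm f g. Proof. by rewrite lfunE /=. Qed.

Lemma ad_comm f g : lfun_comm (ad f) (ad g) = ad (lfun_comm f g).
Proof.
have jacobi (a b c d e h : V) :
    a - b - (c - d) - (e - c - (b - h)) = a - e - (h - d).
  rewrite !opprB addrACA !subrKA addrACA [RHS]addrACA.
  by congr (_ + _); apply: addrC.
apply/lfunP=> k; rewrite lfun_commE !adE; apply/lfunP=> x.
rewrite !(lfun_commE, add_lfunE, opp_lfunE) (linearB f) (linearB g).
rewrite (linearB k); exact: jacobi.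
Qed.

Lemma sl2_triple_ad E F H :
  sl2_triple E F H -> sl2_triple (ad E) (ad F) (ad H).
Proof.
case=> EF HE HF; split; rewrite ad_comm ?EF ?HE ?HF //.
  by apply/lfunP=> k; rewrite scale_lfunE !adE; apply/lfunP=> x;
    rewrite !(lfun_commE, scale_lfunE) linearZ /= scalerBr.
by apply/lfunP=> k; rewrite scale_lfunE !adE; apply/lfunP=> x;
  rewrite !(lfun_commE, scale_lfunE) linearZ /= scalerBr.
Qed.

Lemma iter_ad_apply (E T : 'End(V)) x k :
  E x = 0 -> iter k E (T x) = iter k (ad E) T x.
Proof.
move=> Ex; elim: k => //= k ->.
by rewrite adE lfun_commE Ex linear0 subr0.
Qed.

End Adjoint.

(** * Representations of sl2 as triples *)

Section Rep.
Variables (K : numFieldType) (V : vectType K) (rho : sl2 K -> 'End(V)).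

Lemma sl2_triple_rep : sl2_representation rho ->
  sl2_triple (rho sl2Lam) (rho sl2L) (rho sl2B).
Proof.
case=> lin br; have rhoZ := GRing.scalable_linear lin.
have mulE := (sl2_bracketE, sl2LE, sl2LamE, sl2BE, mulmxBl, mulmxBr,
  mul_delta_mx_cond).
have vsvalZ k (X : sl2 K) : vsval (k *: X) = k *: vsval X.
  by rewrite -[vsval X]/(vsval (X : subvs_of _)) -linearZ.
split; rewrite -br -?rhoZ; congr rho; apply: val_inj;
  rewrite /= ?vsvalZ !mulE /=.
- by rewrite !mulr1n.
- by rewrite !mulr0n !mulr1n sub0r subr0 opprK scaler_nat mulr2n.
by rewrite !mulr0n !mulr1n sub0r subr0 scaleNr scaler_nat mulr2n opprD.
Qed.
End Rep.

(** * Compatible representations on a graded algebra *)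

Section Graded.
Variables (K : numFieldType) (A : falgType K) (N : nat).
Variable (gr : int -> {vspace A}).
Hypothesis hgr : graded_algebra N gr.

Lemma lfun_eq_graded (f g : 'End(A)) :
  (forall n a, a \in gr n -> f a = g a) -> f = g.
Proof.
move=> fg; apply/lfunP=> a; have: a \in fullv by exact: memvf.
rewrite -(graded_full hgr) => /memv_sumP[b bgr ->].
by rewrite !linear_sum; apply: eq_bigr => i _; apply: fg (bgr i _).
Qed.

Lemma homogeneous_comm d e (f g : 'End(A)) :
  homogeneous gr d f -> homogeneous gr e g ->
  homogeneous gr (d + e) (lfun_comm f g).
Proof.
move=> fd ge n a an; rewrite lfun_commE; apply: rpredB.
  by rewrite [d + e]addrC addrA; apply/fd/ge.
by rewrite addrA; apply/ge/fd.
Qed.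

Lemma homogeneous_out d (f : 'End(A)) :
  homogeneous gr d f -> d < - (2 * N)%:Z -> f = 0.
Proof.
move=> fd d_lt; apply: lfun_eq_graded => n a an; rewrite lfunE /=.
have [n_in|n_out] := boolP (0 <= n <= (2 * N)%N%:Z).
  apply/eqP; rewrite -memv0 -(graded_out hgr (n := n + d)) ?fd //.
  by case/andP: n_in => _ n_le; rewrite negb_and -ltNge; lia.
by move: an; rewrite (graded_out hgr n_out) memv0 => /eqP ->; rewrite linear0.
Qed.

Lemma even_parity_part n a :
  a \in gr n%:Z -> ~~ odd n -> a \in parity_part N gr false.
Proof.
move=> an n_even; have [n_le|n_gt] := leqP n (2 * N).
  pose i : 'I_(2 * N).+1 := Ordinal (n_le : (n < (2 * N).+1)%N).
  by apply: (subvP (sumv_sup i _ (subvv _))) an; rewrite (negPf n_even).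
move: an; rewrite (graded_out hgr); last by lia.
by rewrite memv0 => /eqP ->; apply: mem0v.
Qed.

Variable (rho : sl2 K -> 'End(A)).
Hypothesis hrho : compatible N gr rho.
Let L := rho sl2L.
Let Lam := rho sl2Lam.
Let B := rho sl2B.

Let tr : sl2_triple Lam L B := sl2_triple_rep (compatible_rep hrho).

Lemma primitive_weight m a : a \in primitive gr rho m ->
  weight_vector Lam B (N%:R - m%:~R) a.
Proof.
rewrite memv_cap memv_ker => /andP[am /eqP La0].
by split=> //; apply: compatible_B am.
Qed.

(** Iterating [L] leaves the range of degrees, so the weight [N - m] of [a] is
    a natural number unless [a = 0]. *)
Lemma primitive_degree m a : a \in primitive gr rho m ->
  a = 0 \/ exists k : nat, N%:Z - m = k%:Z.
Proof.
move=> aP; have wa := primitive_weight aP.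
have am : a \in gr m by move: aP; rewrite memv_cap => /andP[].
pose k := `|(2 * N)%N%:Z - m|%N.+1.
have: iter k L a = 0.
  apply/eqP; rewrite -memv0 -(graded_out hgr (n := m + 2 * k%:Z)); last first.
    by rewrite negb_and -!ltNge; rewrite /k; lia.
  elim: k => [|k IH]; first by rewrite mulr0 addr0.
  rewrite -[k.+1]addn1 PoszD mulrDr mulr1 addrA addn1 iterS.
  exact: (compatible_L hrho).
case/(natural_weight tr wa) => [|[t]]; first by left.
move/eqP; rewrite -[N%:R]/(N%:Z%:~R) -rmorphB /= -[t%:R]/(t%:Z%:~R) eqr_int.
by move/eqP; right; exists t.
Qed.

Lemma weight_homogeneous d T : homogeneous gr d T -> ad B T = (- d%:~R) *: T.
Proof.
move=> Td; rewrite adE; apply: lfun_eq_graded => n a an.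
rewrite lfun_commE scale_lfunE (compatible_B hrho an).
rewrite (compatible_B hrho (Td _ _ an)) linearZ /= -scalerBl; congr (_ *: _).
by rewrite rmorphD /=; ring.
Qed.

Lemma homogeneous_iter_ad d e E T k :
  homogeneous gr e E -> homogeneous gr d T ->
  homogeneous gr (d + e * k%:Z) (iter k (ad E) T).
Proof.
move=> Ee Td; elim: k => [|k IH]; first by rewrite mulr0 addr0.
rewrite -[k.+1]addn1 PoszD mulrDr mulr1 addrA addrC addn1 iterS adE.
exact: homogeneous_comm.
Qed.

(** Such a [T] is extremal for [ad L] with weight [d], and [ad Lam] is nilpotent
    on it because the degrees of [A] are bounded; its weight would have to be a
    natural number. *)
Lemma commutant_negative_degree d T :
  homogeneous gr d T -> d < 0 -> ad L T = 0 -> T = 0.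
Proof.
move=> Td d_lt LT.
have wT : weight_vector (ad L) (- ad B) d%:~R T.
  by split=> //; rewrite opp_lfunE (weight_homogeneous Td) scaleNr opprK.
case: (natural_weight (k := (2 * N).+1)
  (sl2_triple_swap (sl2_triple_ad tr)) wT) => // [|[t]].
  have Tk := homogeneous_iter_ad (2 * N).+1 (compatible_Lam hrho) Td.
  by apply: homogeneous_out Tk _; lia.
move/eqP; rewrite -[t%:R]/(t%:Z%:~R) eqr_int => /eqP d_t.
by rewrite d_t in d_lt.
Qed.

Variables (v : A) (phi : 'End(A)).
Hypothesis hv : v \in gr 2.
Hypothesis hphi : homogeneous gr 0 phi.
Hypothesis Lphi : lfun_comm L phi = amull v.

Lemma homogeneous_amull : homogeneous gr 2 (amull v).
Proof. by move=> n a an; rewrite lfunE /= addrC; apply: (graded_mul hgr). Qed.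

Hypothesis hcomm : graded_commutative N gr.

(** [L] is multiplication by [L 1], which has even degree like [v]. *)
Lemma L_amull a : L (v * a) = v * L a.
Proof.
have L1 : L 1 \in gr 2.
  by rewrite -[2]add0r; apply: (compatible_L hrho) (graded_one hgr).
have Lmul b : L b = L 1 * b by rewrite -(compatible_mul hrho) mul1r.
rewrite Lmul [in RHS]Lmul !mulrA; congr (_ * a).
have even2 b (b2 : b \in gr 2) : b \in parity_part N gr false.
  exact: (even_parity_part (n := 2)).
by rewrite (hcomm (even2 _ L1) (even2 _ hv)) mul1r.
Qed.

Let wv : weight_vector (ad L) (- ad B) 2 (amull v).
Proof.
split; last first.
  by rewrite opp_lfunE (weight_homogeneous homogeneous_amull) scaleNr opprK.
rewrite adE; apply/lfunP=> a.
by rewrite lfun_commE !lfunE /= L_amull subrr.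
Qed.

(** In [raise_iter] for the string of [V], of weight 2, the third step has the
    factor [2 - 2]: the left side commutes with [L], in degree -4. *)
Lemma ad_Lam3_amull : iter 3 (ad Lam) (amull v) = 0.
Proof.
apply: (@commutant_negative_degree (-4)) => //.
  exact: (homogeneous_iter_ad 3 (compatible_Lam hrho) homogeneous_amull).
rewrite (raise_iter (sl2_triple_swap (sl2_triple_ad tr)) 2 wv).
by rewrite subrr mulr0 scale0r.
Qed.

Lemma double_comm_Lam_phi : iter 2 (ad Lam) (amull v) = 2 *: lfun_comm Lam phi.
Proof.
apply/eqP; rewrite -subr_eq0; apply/eqP.
have trad := sl2_triple_ad tr.
apply: (@commutant_negative_degree (-2)) => //.
  move=> n a an; rewrite add_lfunE opp_lfunE scale_lfunE.
  apply: rpredB.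
    exact: (homogeneous_iter_ad 2 (compatible_Lam hrho) homogeneous_amull).
  by apply: rpredZ; apply: (homogeneous_comm (compatible_Lam hrho) hphi).
rewrite -adE; apply: (weight2_second_lowering (sl2_triple_swap trad) wv).
  by rewrite opp_lfunE (weight_homogeneous hphi) oppr0 scale0r oppr0.
by rewrite adE.
Qed.

Variable (Q : nat -> 'End(A)).
Hypothesis hQ : primitive_components N gr rho v Q.
Variables (m : int) (a : A).
Hypothesis am : a \in primitive gr rho m.

Let Lam_a : Lam a = 0. Proof. by case: (primitive_weight am). Qed.

Let wQ i : weight_vector Lam B (N%:R - (m - 2 * i%:Z + 2)%:~R) (Q i a).
Proof. by apply: primitive_weight; case: (hQ am). Qed.

(** Nonzero [a] has natural weight [k = N - m], so [Q i a] has weight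
    [k + 2 i - 2], which is at least [i] for [i > 2]: its string is long enough
    for [string_components_eq0]. *)
Lemma primitive_component_eq0 i : (2 < i < N.+2)%N -> Q i a = 0.
Proof.
have [->|[k Nm]] := primitive_degree am; first by rewrite linear0.
apply: (string_components_eq0 tr (q := fun i => Q i a) wQ).
  move=> {}i t i_gt t_lt; rewrite -[N%:R]/(N%:Z%:~R) -rmorphB /=.
  rewrite -[t%:R]/(t%:Z%:~R) eqr_int; apply/eqP; lia.
have [_ <-] := hQ am.
have := iter_ad_apply (amull v) 3 Lam_a.
by rewrite ad_Lam3_amull lfunE /= lfunE.
Qed.

Lemma mul_primitive : v * a = Q 0%N a + L (Q 1%N a) + L (L (Q 2%N a)).
Proof.
have [Qa ->] := hQ am; have [N0|] := posnP N.
  (* For N = 0 the sum has no term of index 2; but Q 2 a has degree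
     m - 2, negative unless a = 0. *)
  have [->|[k Nm]] := primitive_degree am.
    by rewrite !linear0 !addr0 big1 // => i _; rewrite linear0 iter_lfun0.
  have -> : Q 2%N a = 0.
    apply/eqP; rewrite -memv0 -(graded_out hgr (n := m - 2 * 2%N%:Z + 2)).
      by move: (Qa 2%N); rewrite memv_cap => /andP[].
    by rewrite negb_and -!ltNge; move: Nm; rewrite N0; lia.
  by rewrite N0 !big_ord_recl big_ord0 !linear0 !addr0.
move/prednK=> DN; rewrite -DN !big_ord_recl.
rewrite big1 /= ?addr0 ?addrA // => i _.
rewrite primitive_component_eq0; first by rewrite iter_lfun0 !linear0.
by have := ltn_ord i; rewrite /bump; lia.
Qed.

Lemma comm_Lam_phi_primitive : let w := N%:R - m%:~R in
  lfun_comm Lam phi a = ((w + 1) * (w + 2)) *: Q 2%N a.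
Proof.
move=> w; have w2 : N%:R - (m - 2 * 2%N%:Z + 2)%:~R = w + 2 :> K.
  by rewrite /w !rmorphD rmorphN /=; ring.
have va : amull v a = v * a by rewrite lfunE.
have := iter_ad_apply (amull v) 2 Lam_a.
rewrite double_comm_Lam_phi scale_lfunE va mul_primitive !iter_lfunD.
rewrite (raise_iter_eq0 tr (k := 2) (i := 0) (wQ 0)) //.
rewrite (raise_iter_eq0 tr (k := 2) (i := 1) (wQ 1)) // !add0r.
rewrite (raise_iter_iter tr 2 (wQ 2)) w2 !big_ord_recr big_ord0 /=.
move=> /esym eq2; have nz2 : 2 != 0 :> K by rewrite pnatr_eq0.
apply: (scalerI nz2); rewrite eq2 scalerA; congr (_ *: _).
by rewrite -[2`!]/2%N; ring.
Qed.

Lemma Lam_L_primitive_component : let w := N%:R - m%:~R in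
  Lam (L (Q 2%N a)) = (w + 2) *: Q 2%N a.
Proof.
move=> w; rewrite (raise_iter tr 0 (wQ 2)) /= ; congr (_ *: _).
by rewrite /w !rmorphD rmorphN /=; ring.
Qed.

End Graded.

(** * The deformed representation on dual numbers *)

Section Deformation.
Variables (K : numFieldType) (A : falgType K) (gr : int -> {vspace A}).
Variables (rho : sl2 K -> 'End(A)) (phi : 'End(A)).

Lemma rho_epsE X x : rho_eps rho phi X x =
  Dual (rho X (dual_re x))
       (rho X (dual_im x) + lfun_comm (rho X) phi (dual_re x)).
Proof. by rewrite add_lfunE dual_extE eps_extE; congr Dual; rewrite /= addr0. Qed.

Lemma comm_of_rho_eps X f :
  rho_eps rho phi X = dual_ext (rho X) + eps_ext f -> lfun_comm (rho X) phi = f.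
Proof.
move/addrI=> eq_eps; apply/lfunP=> a.
have := congr1 (fun g : 'End(dual A) => g (dconst a)) eq_eps.
by rewrite !eps_extE; case.
Qed.

Lemma mem_primitive_eps m x y :
  (Dual x y \in primitive (dual_gr gr) (rho_eps rho phi) m) =
  [&& x \in primitive gr rho m, y \in gr m
    & rho sl2Lam y + lfun_comm (rho sl2Lam) phi x == 0].
Proof.
rewrite {1}/primitive [LHS]memv_cap mem_dual_gr memv_cap !memv_ker rho_epsE.
rewrite /= -!andbA; congr (_ && _).
(* The equality test on pairs unfolds to the conjunction on the right. *)
by rewrite andbCA; congr (_ && _).
Qed.

Lemma mem_primitive_eps0 m y :
  (Dual 0 y \in primitive (dual_gr gr) (rho_eps rho phi) m) =
  (y \in primitive gr rho m).
Proof. by rewrite mem_primitive_eps mem0v !linear0 addr0 memv_cap memv_ker. Qed.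

Variable v : A.
Hypothesis Lphi : lfun_comm (rho sl2L) phi = amull v.
Hypothesis Lv : forall a, rho sl2L (v * a) = v * rho sl2L a.

(** As [V] commutes with [L], the powers of [L + eps V] follow the binomial
    formula, truncated by [eps^2 = 0]. *)
Lemma iter_rho_epsL k x : iter k (rho_eps rho phi sl2L) x =
  Dual (iter k (rho sl2L) (dual_re x))
       (iter k (rho sl2L) (dual_im x)
        + k%:R *: iter k.-1 (rho sl2L) (v * dual_re x)).
Proof.
have Lvk i a : iter i (rho sl2L) (v * a) = v * iter i (rho sl2L) a.
  by elim: i => //= i ->.
elim: k => [|k IH]; first by case: x => a b; rewrite scale0r addr0.
rewrite iterS IH rho_epsE /= linearD linearZ -addrA /= Lphi lfunE /= -Lvk.
congr Dual; congr (_ + _); case: k {IH} => [|k] /=.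
  by rewrite scale0r add0r scale1r.
by rewrite -[k.+2%:R]natr1 scalerDl scale1r.
Qed.

End Deformation.

(** * Primitive decompositions for the deformed representation *)

Theorem proposition1p6 (R : realType) (A : falgType R[i]) (N : nat)
    (gr : int -> {vspace A}) (rho : sl2 R[i] -> 'End(A)) (phi : 'End(A))
    (v : A) (Q : nat -> 'End(A)) (n : int) (j : nat) (alpha : A)
    (hgr : graded_algebra N gr)
    (hcomm : graded_commutative N gr)
    (hrho : compatible N gr rho)
    (hphi : homogeneous gr 0 phi)
    (hrho_eps : compatible N (dual_gr gr) (rho_eps rho phi))
    (hv : v \in gr 2)
    (hL : rho_eps rho phi sl2L = dual_ext (rho sl2L) + eps_ext (amull v))
    (hQ : primitive_components N gr rho v Q)
    (halpha : alpha \in primitive gr rho (n - 2 * j%:Z)) :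
  let L := rho sl2L in
  let Le := rho_eps rho phi sl2L in
  let Pe := primitive (dual_gr gr) (rho_eps rho phi) in
  let c : R[i] := N%:R - n%:~R in
  let x1 := eps * dconst ((c + j%:R + 1) *: Q 2%N alpha) in
  let x0 := dconst alpha -
    eps * dconst ((c + 2 * j%:R + 1) *: L (Q 2%N alpha)
                  + j%:R *: Q 1%N alpha) in
  let xm1 := eps * dconst (j%:R *: Q 0%N alpha) in
  [/\ dconst (iter j L alpha) =
        iter j.+1 Le x1 + iter j Le x0 - iter j.-1 Le xm1,
      x1 \in Pe (n - 2 * (j%:Z + 1)),
      x0 \in Pe (n - 2 * j%:Z)
    & xm1 \in Pe (n - 2 * (j%:Z - 1))].
Proof.
move=> L Le Pe c x1 x0 xm1.
have Lphi := comm_of_rho_eps hL.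
have Lv := L_amull hgr hrho hv hcomm.
have [Qprim _] := hQ _ _ halpha.
have weight_alpha : N%:R - (n - 2 * j%:Z)%:~R = c + 2 * j%:R.
  by rewrite /c rmorphD rmorphN rmorphM /=; ring.
have decomp := mul_primitive hgr hrho hv hcomm hQ halpha.
rewrite /x1 /x0 /xm1 !eps_dconst.
have dconstB y : dconst alpha - Dual 0 y = Dual alpha (- y).
  by congr Dual; rewrite /= ?oppr0 ?addr0 ?add0r.
rewrite dconstB.
split.
- (* For j = 0 the predecessor j.-1 is 0 and only the factor j%:R = 0 makes the
     equation true. *)
  have prod : j%:R *: iter j.-1 L (v * alpha) =
      j%:R *: iter j.-1 L (Q 0%N alpha) + j%:R *: iter j L (Q 1%N alpha)
      + j%:R *: iter j.+1 L (Q 2%N alpha).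
    rewrite decomp; case: (j) => [|k] /=; first by rewrite !scale0r !addr0.
    by rewrite !iter_lfunD !scalerDr -!iterS !iterSr.
  rewrite !(iter_rho_epsL Lphi Lv) -/L [dual_re _]/= [dual_im _]/=.
  congr Dual; rewrite /=.
    by rewrite !iter_lfun0 linear0 add0r subr0.
  rewrite !mulr0 !iter_lfun0 !scaler0 !addr0.
  rewrite -[L (iter j L _)]/(iter j.+1 L _).
  rewrite iter_lfunN iter_lfunD !iter_lfunZ -[iter j L (L _)]iterSr prod.
  have -> : c + 2 * j%:R + 1 = c + j%:R + 1 + j%:R by ring.
  rewrite (scalerDl _ (c + j%:R + 1)); apply/esym/eqP.
  rewrite subr_eq0 addrCA addrC subr_eq.
  apply/eqP; rewrite -[X in _ + X]addrA [LHS]addrCA.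
  by congr (_ + _); rewrite [RHS]addrAC -[RHS]addrA.
- rewrite mem_primitive_eps0 rpredZ //.
  by have -> : n - 2 * (j%:Z + 1) = n - 2 * j%:Z - 2 * 2%N%:Z + 2 by ring.
- rewrite mem_primitive_eps halpha /=; apply/andP; split.
    rewrite rpredN; apply: rpredD; apply: rpredZ.
      have := Qprim 2%N; rewrite memv_cap => /andP[/(compatible_L hrho) + _].
      by congr (_ \in gr _); ring.
    have := Qprim 1%N; rewrite memv_cap => /andP[+ _].
    by congr (_ \in gr _); ring.
  rewrite (comm_Lam_phi_primitive hgr hrho hv hphi Lphi hcomm hQ halpha).
  rewrite linearN linearD !linearZ /=.
  rewrite (Lam_L_primitive_component hrho hQ halpha) weight_alpha.
  have := Qprim 1%N; rewrite memv_cap memv_ker => /andP[_ /eqP ->].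
  by rewrite scaler0 addr0 scalerA addNr.
rewrite mem_primitive_eps0 rpredZ //.
by have -> : n - 2 * (j%:Z - 1) = n - 2 * j%:Z - 2 * 0%N%:Z + 2 by ring.
Qed.
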